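(* A nonzero finite-dimensional Lie algebra $L$ over $\mathbb{F}$ is solvable if and only if its perfect radical $P(L)$ is zero.
   Context: $\mathbb{F}$ denotes either the field of real numbers or the field of complex numbers. An ideal $I$ of a Lie algebra $L$ is called a perfect ideal if $[I,I]=I$, where $[I,I]$ is the linear span of all brackets of elements of $I$; the zero ideal is a perfect ideal. The sum of two perfect ideals is a perfect ideal, so a finite-dimensional Lie algebra $L$ has a largest perfect ideal (one containing all perfect ideals of $L$); it is called the perfect radical of $L$ and denoted $P(L)$. The derived series of $L$ is $L^{(0)}=L$, $L^{(k+1)}=[L^{(k)},L^{(k)}]$, and $L$ is solvable if $L^{(m)}=0$ for some $m$. *)

(* Defs.v *)
From HB Require Import structures.
From mathcomp Require Import all_boot all_order all_algebra.
From mathcomp Require Import complex boolp reals.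

Set Implicit Arguments.
Unset Strict Implicit.
Unset Printing Implicit Defensive.

Import GRing.Theory.
Local Open Scope ring_scope.

HB.mixin Record Vector_isLie (F : fieldType) L of Vector F L := {
  lie_bracket : L -> L -> L;
  lie_linearl : forall (a : F) (x y z : L),
    lie_bracket (a *: x + y) z = a *: lie_bracket x z + lie_bracket y z;
  lie_linearr : forall (a : F) (x y z : L),
    lie_bracket z (a *: x + y) = a *: lie_bracket z x + lie_bracket z y;
  lie_alternating : forall x : L, lie_bracket x x = 0;
  lie_jacobi : forall x y z : L,
    lie_bracket x (lie_bracket y z) + lie_bracket y (lie_bracket z x)
      + lie_bracket z (lie_bracket x y) = 0
}.

(* As every [vectType] is finite-dimensional, so is every [lieAlgType]. *)
#[short(type="lieAlgType")]
HB.structure Definition LieAlgebra (F : fieldType) :=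
  {L of Vector F L & Vector_isLie F L}.

Notation "[ 'lie' x , y ]" := (lie_bracket x y)
  (at level 0, x at level 99, y at level 99, format "[ 'lie'  x ,  y ]")
  : ring_scope.

Section LieTheory.
Variables (F : fieldType) (L : lieAlgType F).
Implicit Types (x y : L) (I J P U V W : {vspace L}).

(* Brackets of basis vectors suffice, by bilinearity: [lie_spanP] shows that
   this is the linear span of all [lie u, v] with u in U and v in V. *)
Definition lie_span U V : {vspace L} :=
  <<[seq [lie u, v] | u <- vbasis U, v <- vbasis V]>>%VS.

Lemma lie_suml n (f : 'I_n -> L) (a : 'I_n -> F) z :
  [lie \sum_i a i *: f i, z] = \sum_i a i *: [lie f i, z].
Proof.
elim: n f a => [|n IHn] f a; last first.
  by rewrite !big_ord_recl lie_linearl IHn.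
rewrite !big_ord0; have := lie_linearl (-1) 0 0 z.
by rewrite scaler0 addr0 scaleN1r addNr.
Qed.

Lemma lie_sumr n (f : 'I_n -> L) (a : 'I_n -> F) z :
  [lie z, \sum_i a i *: f i] = \sum_i a i *: [lie z, f i].
Proof.
elim: n f a => [|n IHn] f a; last first.
  by rewrite !big_ord_recl lie_linearr IHn.
rewrite !big_ord0; have := lie_linearr (-1) 0 0 z.
by rewrite scaler0 addr0 scaleN1r addNr.
Qed.

Lemma mem_lie_span U V : {in U & V, forall u v, [lie u, v] \in lie_span U V}.
Proof.
move=> u v /coord_vbasis-> /coord_vbasis->.
rewrite lie_suml; apply: memv_suml => i _; apply: memvZ.
rewrite lie_sumr; apply: memv_suml => j _; apply: memvZ.
apply/memv_span/allpairsP.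
by exists ((vbasis U)`_i, (vbasis V)`_j); rewrite !memt_nth.
Qed.

Lemma lie_spanP U V W :
  reflect {in U & V, forall u v, [lie u, v] \in W} (lie_span U V <= W)%VS.
Proof.
apply: (iffP idP) => [sUVW u v Uu Vv | sUVW].
  by rewrite (subvP sUVW) ?mem_lie_span.
by apply/span_subvP=> _ /allpairsP[[u v] /= [Uu Vv ->]]; rewrite sUVW ?vbasis_mem.
Qed.

Lemma lie_spanS U1 U2 V1 V2 :
  (U1 <= U2)%VS -> (V1 <= V2)%VS -> (lie_span U1 V1 <= lie_span U2 V2)%VS.
Proof.
move=> /subvP sU /subvP sV; apply/lie_spanP => u v Uu Vv.
by rewrite mem_lie_span ?sU ?sV.
Qed.

Definition lie_ideal I : Prop := forall x y, y \in I -> [lie x, y] \in I.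

Definition perfect_ideal I : Prop := lie_ideal I /\ lie_span I I = I.

Lemma perfect_ideal0 : perfect_ideal 0%VS.
Proof.
have zr x : [lie x, 0] = 0.
  have := lie_linearr (-1) 0 0 x.
  by rewrite scaler0 addr0 scaleN1r addNr.
split=> [x y|]; first by rewrite memv0 => /eqP->; rewrite zr mem0v.
apply/eqP; rewrite -subv0; apply/lie_spanP => u v _.
by rewrite memv0 => /eqP->; rewrite zr mem0v.
Qed.

Lemma perfect_idealD I J :
  perfect_ideal I -> perfect_ideal J -> perfect_ideal (I + J)%VS.
Proof.
move=> [idI pI] [idJ pJ].
have idIJ : lie_ideal (I + J)%VS.
  move=> x _ /memv_addP[u Iu [v Jv ->]].
  rewrite -[u in u + v]scale1r lie_linearr scale1r.
  by apply: memv_add; [apply: idI | apply: idJ].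
split=> //; apply: subv_anti; apply/andP; split.
  by apply/lie_spanP => u v _; apply: idIJ.
rewrite subv_add; apply/andP; split.
  by rewrite -[X in (X <= _)%VS]pI lie_spanS ?addvSl.
by rewrite -[X in (X <= _)%VS]pJ lie_spanS ?addvSr.
Qed.

Lemma exists_largest_perfect_ideal :
  exists P, perfect_ideal P /\ forall I, perfect_ideal I -> (I <= P)%VS.
Proof.
pose has_dim n := `[< exists2 P, perfect_ideal P & \dim P = n >].
have ex0 : exists n, has_dim n.
  by exists (\dim (0 : {vspace L})%VS); apply/asboolP; exists 0%VS => //;
    apply: perfect_ideal0.
have bnd n : has_dim n -> (n <= \dim {:L})%N.
  by move=> /asboolP[P _ <-]; apply/dimvS/subvf.
case: (ex_maxnP ex0 bnd) => n /asboolP[P pP dP] maxn.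
exists P; split=> // I pI.
have : (\dim (P + I)%VS <= \dim P)%N.
  by rewrite dP; apply: maxn; apply/asboolP; exists (P + I)%VS => //;
    apply: perfect_idealD.
rewrite (geq_leqif (dimv_leqif_sup (addvSl P I))) => sPI.
by apply: subv_trans sPI; apply: addvSr.
Qed.

Definition perfect_radical : {vspace L} := sval (cid exists_largest_perfect_ideal).

Lemma perfect_radicalP :
  perfect_ideal perfect_radical /\
  forall I, perfect_ideal I -> (I <= perfect_radical)%VS.
Proof. exact: svalP (cid exists_largest_perfect_ideal). Qed.

Fixpoint derived_series (k : nat) : {vspace L} :=
  if k is k'.+1 then lie_span (derived_series k') (derived_series k')
  else fullv.

Definition lie_solvable : Prop := exists m, derived_series m = 0%VS.

End LieTheory.

Arguments perfect_radical {F} L.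
Arguments derived_series {F} L k.
Arguments lie_solvable {F} L.

(* Main.v *)
Require Import Defs.
From mathcomp Require Import all_boot all_order all_algebra.
From mathcomp Require Import complex reals.

(** A perfect ideal survives every step of the derived series
    ([perfect_ideal_sub_derived]), so the largest one is zero when the series
    reaches zero.  Conversely, the terms of the derived series are ideals
    ([lie_ideal_derived]), and since their dimensions decrease, two consecutive
    terms coincide ([derived_series_stationary]); that common term equals its
    own derived algebra, hence is a perfect ideal.  If the perfect radical is
    zero, this term is zero, and the algebra is solvable. *)

Local Open Scope ring_scope.

Import GRing.Theory.

Section SolvablePerfectRadical.
Variables (F : fieldType) (L : lieAlgType F).
Implicit Types (x y u v : L) (I U V W : {vspace L}).

Lemma lieDl x y u : [lie x + y, u] = [lie x, u] + [lie y, u].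
Proof. by have := lie_linearl 1 x y u; rewrite !scale1r. Qed.

Lemma lieDr x y u : [lie u, x + y] = [lie u, x] + [lie u, y].
Proof. by have := lie_linearr 1 x y u; rewrite !scale1r. Qed.

(** Polarization: expand [[lie x + y, x + y] = 0]. *)
Lemma lie_anticomm x y : [lie x, y] = - [lie y, x].
Proof.
apply/eqP; rewrite -addr_eq0; apply/eqP.
have := lie_alternating (x + y).
by rewrite lieDl !lieDr !lie_alternating add0r addr0.
Qed.

Lemma lieNr x u : [lie u, - x] = - [lie u, x].
Proof.
have lie0r : [lie u, 0] = 0.
  by apply: (addrI [lie u, 0]); rewrite -lieDr !addr0.
by apply/eqP; rewrite -addr_eq0 -lieDr addNr lie0r.
Qed.

(** The Jacobi identity says that bracketing with [x] is a derivation. *)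
Lemma lie_leibniz x u v :
  [lie x, [lie u, v]] = [lie [lie x, u], v] + [lie u, [lie x, v]].
Proof.
have /eqP := lie_jacobi x u v.
rewrite (lie_anticomm v x) lieNr (lie_anticomm v [lie x, u]).
by rewrite -addrA addr_eq0 opprD !opprK addrC => /eqP ->; rewrite addrC.
Qed.

(** To bracket a whole span into [W] it is enough to bracket its generators,
    since [lie_bracket x] is linear. *)
Lemma lie_span_stable x U V W :
  (forall u v, u \in U -> v \in V -> [lie x, [lie u, v]] \in W) ->
  forall y, y \in lie_span U V -> [lie x, y] \in W.
Proof.
move=> xUV y; rewrite /lie_span -[X in <<X>>%VS]in_tupleE => /coord_span ->.
rewrite lie_sumr; apply: memv_suml => i _; apply: memvZ.
set s := in_tuple _.
have /allpairsP[[u v] /= [Uu Vv ->]] : s`_i \in s by rewrite mem_nth.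
by apply: xUV; apply: vbasis_mem.
Qed.

(** Bracketing with [x] is a derivation, so it maps a bracket of elements of
    two ideals to a sum of two such brackets. *)
Lemma lie_ideal_span U V :
  lie_ideal U -> lie_ideal V -> lie_ideal (lie_span U V).
Proof.
move=> idU idV x; apply: lie_span_stable => u v Uu Vv.
by rewrite lie_leibniz memvD ?mem_lie_span ?idU ?idV.
Qed.

Lemma lie_ideal_derived k : lie_ideal (derived_series L k).
Proof.
elim: k => [|k IHk]; first by move=> x y _; rewrite memvf.
exact: lie_ideal_span.
Qed.

Lemma derived_series_decr k :
  (derived_series L k.+1 <= derived_series L k)%VS.
Proof. by apply/lie_spanP => u v _; apply: lie_ideal_derived. Qed.

Lemma perfect_ideal_sub_derived I k :
  perfect_ideal I -> (I <= derived_series L k)%VS.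
Proof.
move=> [_ pI]; elim: k => [|k IHk]; first exact: subvf.
by rewrite -[X in (X <= _)%VS]pI lie_spanS.
Qed.

(** Each strict inclusion in the decreasing series costs a dimension, so there
    are only finitely many. *)
Lemma derived_series_stationary :
  exists k, derived_series L k.+1 = derived_series L k.
Proof.
suff main n k : (\dim (derived_series L k) < n)%N ->
    exists k, derived_series L k.+1 = derived_series L k.
  exact: (main _ 0 (ltnSn _)).
elim: n k => // n IHn k dim_k.
have [eq_k | neq_k] := eqVneq (derived_series L k.+1) (derived_series L k).
  by exists k.
apply: (IHn k.+1); apply: leq_trans (ltnSE dim_k).
rewrite ltn_neqAle dimvS ?derived_series_decr // andbT.
by rewrite (dimv_leqif_eq (derived_series_decr k)).
Qed.

Lemma lie_solvable_perfect_radical :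
  lie_solvable L <-> perfect_radical L = 0%VS.
Proof.
have [perfP maxP] := perfect_radicalP L.
split=> [[m Dm0] | P0].
  by apply/eqP; rewrite -subv0 -Dm0 perfect_ideal_sub_derived.
have [k Dk] := derived_series_stationary.
have perfD : perfect_ideal (derived_series L k).
  by split=> //; apply: lie_ideal_derived.
by exists k; apply/eqP; rewrite -subv0 -P0 maxP.
Qed.

End SolvablePerfectRadical.

Theorem proposition2p2 (R : realType) :
  (forall L : lieAlgType R, (exists x : L, x != 0) ->
     (lie_solvable L <-> perfect_radical L = 0%VS))
  /\
  (forall L : lieAlgType R[i], (exists x : L, x != 0) ->
     (lie_solvable L <-> perfect_radical L = 0%VS)).
Proof. by split=> L _; apply: lie_solvable_perfect_radical. Qed.
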